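(* Let $X,P$ be metric spaces, $Y$ a normed vector space, $H:X\times P\rightrightarrows Y$ a set-valued map and $(\overline{x},\overline{p},0)\in\operatorname{Gr}H$. Denote $H_p(\cdot):=H(\cdot,p)$, $H_x(\cdot):=H(x,\cdot)$, and define $S:P\rightrightarrows X$ by $S(p):=\{x\in X\mid 0\in H(x,p)\}$. (i) If $H_{\overline{p}}$ is linearly pseudo-open with modulus $c>0$ at $(\overline{x},0)$, then there exist $\alpha,\beta>0$ such that, for every $x\in B(\overline{x},\alpha)$, $$d(x,S(\overline{p}))\leq c^{-1}d(0,H(x,\overline{p})\cap B(0,\beta)).$$ If, moreover, $H$ is calm with respect to $p$ uniformly in $x$ at $((\overline{x},\overline{p}),0)$, then $S$ is calm at $(\overline{p},\overline{x})$ and $$\operatorname{clm}S(\overline{p},\overline{x})\leq c^{-1}\,\widehat{\operatorname{clm}}_pH((\overline{x},\overline{p}),0).$$ (ii) If $H_{\overline{x}}$ is linearly pseudo-open with modulus $c>0$ at $(\overline{p},0)$, then there exist $\gamma,\delta>0$ such that, for every $p\in B(\overline{p},\gamma)$, $$d(p,S^{-1}(\overline{x}))\leq c^{-1}d(0,H(\overline{x},p)\cap B(0,\delta)).$$ If, moreover, $H$ is calm with respect to $x$ uniformly in $p$ at $((\overline{x},\overline{p}),0)$, then $S$ is metrically subregular at $(\overline{p},\overline{x})$ and $$\operatorname{subreg}S(\overline{p},\overline{x})\leq c^{-1}\,\widehat{\operatorname{clm}}_xH((\overline{x},\overline{p}),0).$$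
   Context: $B(x,r)$ is the open ball; $\mathcal{V}(x)$ is the set of neighborhoods of $x$. $d(x,A)=\inf_{a\in A}d(x,a)$ with $d(x,\emptyset)=\infty$; the excess is $e(A,B)=\sup\{d(a,B)\mid a\in A\}$ (with $e(\emptyset,B)=0$). For a multifunction $F$: $\operatorname{Gr}F=\{(x,y)\mid y\in F(x)\}$, $F(A)=\bigcup_{x\in A}F(x)$, $F^{-1}(y)=\{x\mid y\in F(x)\}$. For $F:X\rightrightarrows Y$ between metric spaces, $(\overline{x},\overline{y})\in\operatorname{Gr}F$ and $L>0$: - $F$ is linearly pseudo-open with modulus $L$ at $(\overline{x},\overline{y})$ if there exist $U\in\mathcal{V}(\overline{x})$ and $\varepsilon>0$ such that for every $\rho\in(0,\varepsilon)$ and every $x\in U\cap F^{-1}(B(\overline{y},L\rho))$ one has $\overline{y}\in F(B(x,\rho))$. - $F$ is calm with constant $L$ at $(\overline{x},\overline{y})$ if there exist $U\in\mathcal{V}(\overline{x})$, $V\in\mathcal{V}(\overline{y})$ with $e(F(x)\cap V,F(\overline{x}))\leq L\,d(x,\overline{x})$ for every $x\in U$; $\operatorname{clm}F(\overline{x},\overline{y})$ is the infimum of such $L$. - $F$ is metrically subregular with constant $L$ at $(\overline{x},\overline{y})$ if there exists $U\in\mathcal{V}(\overline{x})$ with $d(x,F^{-1}(\overline{y}))\leq L\,d(\overline{y},F(x))$ for every $x\in U$; $\operatorname{subreg}F(\overline{x},\overline{y})$ is the infimum of such $L$. For $H:X\times P\rightrightarrows Y$ and $((\overline{x},\overline{p}),\overline{y})\in\operatorname{Gr}H$: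 $H$ is calm with respect to $x$ uniformly in $p$ at $((\overline{x},\overline{p}),\overline{y})$ with constant $L>0$ if there exist $U\in\mathcal{V}(\overline{x})$, $V\in\mathcal{V}(\overline{p})$, $W\in\mathcal{V}(\overline{y})$ such that $e(H(x,p)\cap W,H(\overline{x},p))\leq L\,d(x,\overline{x})$ for all $x\in U$, $p\in V$; the infimum of such $L$ is $\widehat{\operatorname{clm}}_xH((\overline{x},\overline{p}),\overline{y})$. Symmetrically, $H$ is calm with respect to $p$ uniformly in $x$ with constant $L$ if for such neighborhoods $e(H(x,p)\cap W,H(x,\overline{p}))\leq L\,d(p,\overline{p})$ for all $x\in U$, $p\in V$; the infimum of such $L$ is $\widehat{\operatorname{clm}}_pH((\overline{x},\overline{p}),\overline{y})$. Calmness or subregularity without mention of a constant means that it holds for some $L>0$. *)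

(* Defs.v *)
From HB Require Import structures.
From mathcomp Require Import all_boot all_order all_algebra.
From mathcomp Require Import all_classical all_reals all_analysis.

Set Implicit Arguments.
Unset Strict Implicit.
Unset Printing Implicit Defensive.

Import Order.TTheory GRing.Theory Num.Theory.
Import numFieldNormedType.Exports.

Local Open Scope classical_set_scope.
Local Open Scope ring_scope.
Local Open Scope ereal_scope.

(* [normedModType R] does not inherit from [metricType R], so the notions below
   are stated over their common ancestor [pseudoMetricType R], with the distance
   [edist] of the library and the distance to a set [edist_inf A x], which is
   +oo when [A] is empty. [edist_mdist] and [edist_norm] check that [edist] is
   the usual distance on metric spaces and on normed spaces. *)

Lemma edist_lt_ball (R : realType) (M : pseudoMetricType R) (d : M -> M -> R) :
  (forall x y, (0 <= d x y)%R) ->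
  (forall x r, ball x r = [set y | (d x y < r)%R]) ->
  forall x y, edist (x, y) = (d x y)%:E.
Proof.
move=> d0 dE x y; apply/eqP; rewrite eq_le; apply/andP; split.
- apply/lee_addgt0Pr => e e0; rewrite -EFinD.
  apply: ereal_inf_lbound; exists (d x y + e)%R => //; split.
    by rewrite ltr_wpDl.
  by rewrite dE /= ltrDl.
- apply: le_ereal_inf_tmp => _ [r [r0 +] <-]; rewrite dE /= => xyr.
  by rewrite lee_fin ltW.
Qed.

Lemma edist_mdist (R : realType) (M : metricType R) (x y : M) :
  edist (x, y) = (mdist x y)%:E.
Proof.
by apply: edist_lt_ball => *; [exact: mdist_ge0 | exact: ballEmdist].
Qed.

Lemma edist_norm (R : realType) (V : normedModType R) (x y : V) :
  edist (x, y) = (`|x - y|)%:E.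
Proof.
apply: (@edist_lt_ball R V (fun x y => `|x - y|%R)) => // {}x r.
by rewrite -ball_normE.
Qed.

Definition excess (R : realType) (M : pseudoMetricType R) (A B : set M) : \bar R :=
  if A == set0 then 0 else ereal_sup [set edist_inf B a | a in A].

Definition mimage (X Y : Type) (F : X -> set Y) (A : set X) : set Y :=
  \bigcup_(x in A) F x.

Definition minv (X Y : Type) (F : X -> set Y) : Y -> set X :=
  fun y => [set x | F x y].

Section single_variable.
Context (R : realType) (X Y : pseudoMetricType R).
Implicit Types (F : X -> set Y) (L : R) (x : X) (y : Y).

Definition linearly_pseudo_open F L x0 y0 : Prop :=
  exists (U : set X) (e : R), [/\ nbhs x0 U, (0 < e)%R &
    forall rho : R, (0 < rho < e)%R ->
    forall x, (U `&` mimage (minv F) (ball y0 (L * rho)%R)) x ->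
      mimage F (ball x rho) y0].

Definition calm_with F L x0 y0 : Prop :=
  exists (U : set X) (V : set Y), [/\ nbhs x0 U, nbhs y0 V &
    forall x, U x -> excess (F x `&` V) (F x0) <= L%:E * edist (x, x0)].

Definition calm F x0 y0 : Prop :=
  exists2 L : R, (0 < L)%R & calm_with F L x0 y0.

Definition clm F x0 y0 : \bar R :=
  ereal_inf [set L%:E | L in [set L : R | (0 < L)%R /\ calm_with F L x0 y0]].

Definition subregular_with F L x0 y0 : Prop :=
  exists U : set X, nbhs x0 U /\
    forall x, U x -> edist_inf (minv F y0) x <= L%:E * edist_inf (F x) y0.

Definition subregular F x0 y0 : Prop :=
  exists2 L : R, (0 < L)%R & subregular_with F L x0 y0.

Definition subreg F x0 y0 : \bar R :=
  ereal_inf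
    [set L%:E | L in [set L : R | (0 < L)%R /\ subregular_with F L x0 y0]].

End single_variable.

Section two_variables.
Context (R : realType) (X P Y : pseudoMetricType R).
Implicit Types (H : X * P -> set Y) (L : R) (x : X) (p : P) (y : Y).

Definition calm_x_unif_with H L x0 p0 y0 : Prop :=
  exists (U : set X) (V : set P) (W : set Y),
    [/\ nbhs x0 U, nbhs p0 V, nbhs y0 W & forall x p, U x -> V p ->
      excess (H (x, p) `&` W) (H (x0, p)) <= L%:E * edist (x, x0)].

Definition calm_x_unif H x0 p0 y0 : Prop :=
  exists2 L : R, (0 < L)%R & calm_x_unif_with H L x0 p0 y0.

Definition clm_x_unif H x0 p0 y0 : \bar R :=
  ereal_inf
    [set L%:E | L in [set L : R | (0 < L)%R /\ calm_x_unif_with H L x0 p0 y0]].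

Definition calm_p_unif_with H L x0 p0 y0 : Prop :=
  exists (U : set X) (V : set P) (W : set Y),
    [/\ nbhs x0 U, nbhs p0 V, nbhs y0 W & forall x p, U x -> V p ->
      excess (H (x, p) `&` W) (H (x, p0)) <= L%:E * edist (p, p0)].

Definition calm_p_unif H x0 p0 y0 : Prop :=
  exists2 L : R, (0 < L)%R & calm_p_unif_with H L x0 p0 y0.

Definition clm_p_unif H x0 p0 y0 : \bar R :=
  ereal_inf
    [set L%:E | L in [set L : R | (0 < L)%R /\ calm_p_unif_with H L x0 p0 y0]].

End two_variables.

Definition solution_map (R : realType) (X P : Type) (Y : normedModType R)
  (H : X * P -> set Y) : P -> set X := fun p => [set x | H (x, p) 0%R].

(* Main.v *)
(** Openness at every small radius [rho > d(y0, y) / c], with [y] in [F z],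
    produces a point [z'] of [F^-1 y0] within [rho] of [z]; letting [rho] decrease
    gives [d(z, F^-1 y0) <= d(y0, F z) / c] when [F z] comes close to [y0].
    If [x] solves the problem at [p], uniform calmness bounds the distance from
    [0] to the value of [H] at the point where one variable is reset to its
    reference value, and the previous inequality turns this bound into a bound
    on the distance to a solution. *)
Require Import Defs.
From mathcomp Require Import all_boot all_order all_algebra.
From mathcomp Require Import all_classical all_reals all_analysis.

Import Order.TTheory GRing.Theory Num.Theory.
Import numFieldNormedType.Exports.

Local Open Scope classical_set_scope.
Local Open Scope ring_scope.
Local Open Scope ereal_scope.

Section distance_lemmas.
Context {R : realType}.

Lemma edist_inf_le {M : pseudoMetricType R} {A : set M} {x a : M} :
  A a -> edist_inf A x <= edist (x, a).
Proof. by move=> Aa; apply: ereal_inf_lbound; exists a. Qed.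

(** Points of [A] that nearly attain the distance already lie in [ball x r], so the truncation
    discards only points that are too far to matter. *)
Lemma edist_inf_setI_ball {M : pseudoMetricType R} {A : set M} {x : M} {r : R} :
  edist_inf A x < r%:E -> edist_inf (A `&` ball x r) x <= edist_inf A x.
Proof.
move=> Axr; rewrite leNgt; apply/negP => AIx.
have /ereal_inf_lt[_ [a Aa <-]] :
    edist_inf A x < Order.min r%:E (edist_inf (A `&` ball x r) x).
  by rewrite lt_min Axr.
rewrite lt_min => /andP[/edist_lt_ball axr]; apply/negP; rewrite -leNgt.
exact: edist_inf_le.
Qed.

Lemma edist_inf_le_excess {M : pseudoMetricType R} {A B : set M} {a : M} :
  A a -> edist_inf B a <= excess A B.
Proof.
move=> Aa; rewrite /excess ifF; last by apply/negP => /eqP A0; rewrite A0 in Aa.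
by apply: ereal_sup_ubound; exists a.
Qed.

(** The bound [0 <= t] settles the case of empty [A], where the excess is 0 by convention. *)
Lemma excess_le {M : pseudoMetricType R} {A B : set M} {t : \bar R} :
  0 <= t -> (forall a, A a -> edist_inf B a <= t) -> excess A B <= t.
Proof.
move=> t0 ABt; rewrite /excess; case: ifP => // _.
by apply: ge_ereal_sup => _ [a /ABt ? <-].
Qed.

Lemma near_edist_lt {M : pseudoMetricType R} (x : M) {r : R} :
  (0 < r)%R -> \forall y \near x, edist (y, x) < r%:E.
Proof.
move=> r0; have r20 : (0 < r / 2)%R by rewrite divr_gt0.
near=> y; rewrite edist_sym (@le_lt_trans _ _ (r / 2)%:E)//.
  by apply: edist_fin => //=; near: y; exact: nbhsx_ballx.
by rewrite lte_fin ltr_pdivrMr// ltr_pMr// ltr1n.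
Unshelve. all: by end_near. Qed.

(** Carries a passage between admissible constants over to the infima that define [clm] and
    [subreg]. *)
Lemma le_ereal_inf_scale {A B : set R} {c : R} : (0 < c)%R ->
  (forall L, A L -> B (c^-1 * L)%R) ->
  ereal_inf [set L%:E | L in B] <= (c^-1)%:E * ereal_inf [set L%:E | L in A].
Proof.
move=> c0 AB; rewrite lee_pdivlMl//.
apply: le_ereal_inf_tmp => _ [L AL <-].
rewrite -lee_pdivlMl// -EFinM; apply: ereal_inf_lbound.
by exists (c^-1 * L)%R => //; exact: AB.
Qed.

End distance_lemmas.

Section pseudo_openness.
Context {R : realType} {Z Y : pseudoMetricType R}.
Context {F : Z -> set Y} {c : R} {z0 : Z} {y0 : Y}.
Context (c0 : (0 < c)%R) (Fopen : linearly_pseudo_open F c z0 y0).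

Lemma linearly_pseudo_open_edist_inf :
  exists a b : R, [/\ (0 < a)%R, (0 < b)%R & forall z, ball z0 a z ->
    edist_inf (minv F y0) z <= (c^-1)%:E * edist_inf (F z `&` ball y0 b) y0].
Proof.
have [U [e [/nbhs_ballP[a a0 aU] e0 Fe]]] := Fopen.
have ce0 : (0 < c * e / 2)%R by rewrite divr_gt0// mulr_gt0.
(* Half of [c * e] is taken because ball membership is used only as a non-strict bound on [edist],
   while [t / c < e] must be strict. *)
exists a, (c * e / 2)%R; split=> // z /aU Uz.
rewrite lee_pdivlMl//; apply: le_ereal_inf_tmp => _ [y [Fzy y0y] <-].
have ye : edist (y0, y) < (c * e)%:E.
  rewrite (@le_lt_trans _ _ (c * e / 2)%:E)//; first exact: edist_fin.
  by rewrite lte_fin ltr_pdivrMr// ltr_pMr ?ltr1n// mulr_gt0.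
have [t yt] : exists t, edist (y0, y) = t%:E.
  exists (fine (edist (y0, y))); rewrite fineK// ge0_fin_numE//.
  by rewrite (lt_trans ye)// ltry.
have t0 : (0 <= t)%R by rewrite -lee_fin -yt edist_ge0.
rewrite yt lte_fin in ye; rewrite yt -lee_pdivlMl// -EFinM mulrC.
(* Openness applies to every radius in ]t / c, e[. *)
apply/lee_addgt0Pr => d d0; rewrite -EFinD.
(* Both terms exceed [t / c]; the first keeps [rho] within [d] of it, the midpoint keeps [rho] below
   [e]. *)
pose rho := Num.min (t / c + d)%R ((t / c + e) / 2)%R.
have tce : (t / c < e)%R by rewrite ltr_pdivrMr// mulrC.
have trho : (t / c < rho)%R by rewrite lt_min ltrDl d0 midf_lt.
have rhoe : (rho < e)%R by rewrite gt_min midf_lt// orbT.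
have rho0 : (0 < rho)%R by rewrite (le_lt_trans _ trho)// divr_ge0// ltW.
have rho_itv : (0 < rho < e)%R by rewrite rho0.
have [|z' zz' Fz'] := Fe rho rho_itv z.
  split=> //; exists y => //; apply: (@edist_lt_ball _ _ _ (y0, y)).
  by rewrite yt lte_fin mulrC -ltr_pdivrMr.
rewrite (@le_trans _ _ rho%:E)//; last by rewrite lee_fin ge_min lexx.
apply: (@le_trans _ _ (edist (z, z'))); first exact: edist_inf_le.
exact: edist_fin.
Qed.

(** Removes the truncation: for [t < b / L] the distance from [y0] to [F z] is below [b], so
    intersecting with the ball of radius [b] does not increase it. *)
Lemma linearly_pseudo_open_edist_inf_le {L : R} : (0 < L)%R ->
  exists a r : R, [/\ (0 < a)%R, (0 < r)%R & forall z t, ball z0 a z ->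
    t < r%:E -> edist_inf (F z) y0 <= L%:E * t ->
    edist_inf (minv F y0) z <= (c^-1 * L)%:E * t].
Proof.
move=> L0; have [a [b [a0 b0 Fab]]] := linearly_pseudo_open_edist_inf.
exists a, (L^-1 * b)%R; split=> // [|z t az tb Ft].
  by rewrite mulr_gt0// invr_gt0.
rewrite (le_trans (Fab _ az))// EFinM -muleA lee_pmul2l// ?lte_fin ?invr_gt0//.
apply: (le_trans _ Ft); apply: edist_inf_setI_ball.
by rewrite (le_lt_trans Ft)// -lte_pdivlMl// -EFinM.
Qed.

End pseudo_openness.

Section solution_map.
Context {R : realType} {X P : metricType R} {Y : normedModType R}.
Context {H : X * P -> set Y} {xbar : X} {pbar : P} {c L : R}.
Context (c0 : (0 < c)%R) (L0 : (0 < L)%R).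

Lemma calm_with_solution_map :
  linearly_pseudo_open (fun x => H (x, pbar)) c xbar (0%R : Y) ->
  calm_p_unif_with H L xbar pbar (0%R : Y) ->
  calm_with (solution_map H) (c^-1 * L)%R pbar xbar.
Proof.
move=> Hopen [U [V [W [xU pV W0 HL]]]].
have [a [r [a0 r0 Har]]] := linearly_pseudo_open_edist_inf_le c0 Hopen L0.
(* The bound on [edist (p, pbar)] makes it an admissible [t] in [Har]. *)
exists (V `&` [set p | edist (p, pbar) < r%:E]), (U `&` ball xbar a); split.
- by apply: filterI => //; exact: near_edist_lt.
- by apply: filterI => //; exact: nbhsx_ballx.
move=> p [Vp pr]; apply: excess_le => [|x [Sx [Ux ax]]].
  by rewrite mule_ge0// lee_fin mulr_ge0 ?invr_ge0 ?ltW.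
apply: (Har x) => //; apply: le_trans (HL _ _ Ux Vp).
by apply: edist_inf_le_excess; split=> //; exact: nbhs_singleton.
Qed.

Lemma subregular_with_solution_map :
  H (xbar, pbar) 0%R ->
  linearly_pseudo_open (fun p => H (xbar, p)) c pbar (0%R : Y) ->
  calm_x_unif_with H L xbar pbar (0%R : Y) ->
  subregular_with (solution_map H) (c^-1 * L)%R pbar xbar.
Proof.
move=> H0 Hopen [U [V [W [/nbhs_ballP[u u0 uU] pV W0 HL]]]].
have [a [r [a0 r0 Har]]] := linearly_pseudo_open_edist_inf_le c0 Hopen L0.
have cL0 : (0 < c^-1 * L)%R by rewrite mulr_gt0 ?invr_gt0.
have m0 : (0 < Num.min r u)%R by rewrite lt_min r0.
(* Subregularity does not localise [S p] near [xbar]. This radius ensures that any [x] at distance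
   at least [min r u] from [xbar] satisfies the estimate through [d(p, pbar)] alone. *)
exists (V `&` ball pbar a `&`
  [set p | edist (p, pbar) < (c^-1 * L * Num.min r u)%:E]); split.
  apply: filterI; first by apply: filterI => //; exact: nbhsx_ballx.
  by apply: near_edist_lt; rewrite mulr_gt0.
move=> p [[Vp ap] pm].
rewrite -lee_pdivrMl//; apply: le_ereal_inf_tmp => _ [x Sx <-].
rewrite lee_pdivrMl//.
have [xm|mx] := ltP (edist (xbar, x)) (Num.min r u)%:E.
  (* Near [xbar], [x] lies in [U], and [edist (x, xbar)] is an admissible [t] in [Har]. *)
  move: xm; rewrite EFin_min lt_min => /andP[xr /edist_lt_ball/uU Ux].
  apply: (Har p) => //; rewrite edist_sym; apply: le_trans (HL _ _ Ux Vp).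
  by apply: edist_inf_le_excess; split=> //; exact: nbhs_singleton.
(* Far from [xbar], it suffices that [pbar] is a point of [S^-1 xbar]. *)
rewrite (@le_trans _ _ (edist (p, pbar)))//; first exact: edist_inf_le.
by rewrite (le_trans (ltW pm))// EFinM lee_pmul2l.
Qed.

End solution_map.

Theorem theorem3p1 (R : realType) (X P : metricType R) (Y : normedModType R)
    (H : X * P -> set Y) (xbar : X) (pbar : P) (c : R) :
  H (xbar, pbar) 0%R ->
  (0 < c)%R ->
  let S := solution_map H in
  (linearly_pseudo_open (fun x => H (x, pbar)) c xbar (0%R : Y) ->
    (exists alpha beta : R, [/\ (0 < alpha)%R, (0 < beta)%R &
      forall x, ball xbar alpha x ->
        edist_inf (S pbar) x <=
        (c^-1)%:E * edist_inf (H (x, pbar) `&` ball (0%R : Y) beta) (0%R : Y)]) /\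
    (calm_p_unif H xbar pbar (0%R : Y) ->
      calm S pbar xbar /\
      clm S pbar xbar <= (c^-1)%:E * clm_p_unif H xbar pbar (0%R : Y))) /\
  (linearly_pseudo_open (fun p => H (xbar, p)) c pbar (0%R : Y) ->
    (exists gamma delta : R, [/\ (0 < gamma)%R, (0 < delta)%R &
      forall p, ball pbar gamma p ->
        edist_inf (minv S xbar) p <=
        (c^-1)%:E * edist_inf (H (xbar, p) `&` ball (0%R : Y) delta) (0%R : Y)]) /\
    (calm_x_unif H xbar pbar (0%R : Y) ->
      subregular S pbar xbar /\
      subreg S pbar xbar <= (c^-1)%:E * clm_x_unif H xbar pbar (0%R : Y))).
Proof.
move=> H0 c0 S; split=> Hopen; split.
- exact: linearly_pseudo_open_edist_inf c0 Hopen.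
- move=> [L L0 HL]; split.
    exists (c^-1 * L)%R; first by rewrite mulr_gt0 ?invr_gt0.
    exact: calm_with_solution_map.
  apply: le_ereal_inf_scale => // K [K0 HK].
  by split; [rewrite mulr_gt0 ?invr_gt0 | exact: calm_with_solution_map].
- exact: linearly_pseudo_open_edist_inf c0 Hopen.
- move=> [L L0 HL]; split.
    exists (c^-1 * L)%R; first by rewrite mulr_gt0 ?invr_gt0.
    exact: subregular_with_solution_map.
  apply: le_ereal_inf_scale => // K [K0 HK].
  by split; [rewrite mulr_gt0 ?invr_gt0 | exact: subregular_with_solution_map].
Qed.
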